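(* Let $(X,\eta)$ be a $UCW$-hyperbolic space, $C\subseteq X$ a nonempty convex subset, and $T,U:C\to C$ nonexpansive mappings with $Fix(T)\cap Fix(U)\neq\emptyset$. Let $x_0,u\in C$, let $(\alpha_n)_{n\in\mathbb N},(\beta_n)_{n\in\mathbb N}$ be sequences in $[0,1]$, and let $(x_n),(y_n)$ be the alternating Halpern-Mann iteration: for all $n\in\mathbb N$, $y_n=(1-\alpha_n)Tx_n+\alpha_n u$ and $x_{n+1}=(1-\beta_n)Uy_n+\beta_n y_n$. Let $p\in Fix(T)\cap Fix(U)$, $M_p=\max\{d(x_0,p),d(u,p)\}$, and let $K\in\mathbb N$, $K\geq1$, satisfy $K\geq M_p$. Assume that - $\lim_{n\to\infty}\alpha_n=0$ with rate of convergence $\sigma_1:\mathbb N\to\mathbb N$; - $\Lambda\in\mathbb N$ satisfies $\Lambda\geq2$ and $\frac1\Lambda\le\beta_n\le1-\frac1\Lambda$ for all $n\in\mathbb N$; - $(x_n)$ is asymptotically regular with rate $\Delta:\mathbb N\to\mathbb N$. Then: (i) $(y_n)$ is $U$-asymptotically regular with rate $\Gamma_3(k)=\max\{\Delta(2P(k+1)-1),\ \sigma_1(2PK(k+1)-1)\}$, where $P=\left\lceil\frac{\Lambda^2}{\eta\left(K,\frac1{K(k+1)}\right)}\right\rceil$ (depending on $k$). (ii) $\lim_{n\to\infty}d(x_n,y_n)=0$ with rate of convergence $\Omega(k)=\max\{\Delta(2k+1),\Gamma_3(2k+1)\}$. (iii) $(y_n)$ is $T$-asymptotically regular with rate $\Gamma_4(k)=\max\{\Omega(2k+1),\sigma_1(4K(k+1)-1)\}$.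 (iv) $(x_n)$ is $U$-asymptotically regular with rate $\Gamma_5(k)=\max\{\Omega(4k+3),\Gamma_3(2k+1)\}$. (v) $(x_n)$ is $T$-asymptotically regular with rate $\Gamma_6(k)=\max\{\Omega(4k+3),\Gamma_4(2k+1)\}$.
   Context: $\mathbb N=\{0,1,2,\dots\}$. A $W$-hyperbolic space is a metric space $(X,d)$ with a function $W:X\times X\times[0,1]\to X$, where $(1-\lambda)x+\lambda y$ denotes $W(x,y,\lambda)$, such that for all $x,y,w,z\in X$ and $\lambda,\tilde\lambda\in[0,1]$: (W1) $d(z,(1-\lambda)x+\lambda y)\le(1-\lambda)d(z,x)+\lambda d(z,y)$; (W2) $d((1-\lambda)x+\lambda y,(1-\tilde\lambda)x+\tilde\lambda y)=|\lambda-\tilde\lambda|d(x,y)$; (W3) $(1-\lambda)x+\lambda y=\lambda y+(1-\lambda)x$, i.e. $W(x,y,\lambda)=W(y,x,1-\lambda)$; (W4) $d((1-\lambda)x+\lambda z,(1-\lambda)y+\lambda w)\le(1-\lambda)d(x,y)+\lambda d(z,w)$. A $UCW$-hyperbolic space is a pair $(X,\eta)$ where $X$ is a $W$-hyperbolic space and $\eta:(0,\infty)\times(0,2]\to(0,1]$ (a monotone modulus of uniform convexity) satisfies: (a) for all $r>0$, $\varepsilon\in(0,2]$ and $x,y,a\in X$, if $d(x,a)\le r$, $d(y,a)\le r$ and $d(x,y)\ge\varepsilon r$, then $d\left(\frac12x+\frac12y,a\right)\le(1-\eta(r,\varepsilon))r$; (b) for every $\varepsilon\in(0,2]$, if $0<r\le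 s$ then $\eta(s,\varepsilon)\le\eta(r,\varepsilon)$. A nonempty $C\subseteq X$ is convex if $(1-\lambda)x+\lambda y\in C$ for all $x,y\in C$, $\lambda\in[0,1]$. A mapping $S:C\to C$ is nonexpansive if $d(Sx,Sy)\le d(x,y)$ for all $x,y\in C$; $Fix(S)$ is its set of fixed points. $\varphi:\mathbb N\to\mathbb N$ is a rate of convergence of a real sequence $(a_n)$ towards $0$ if $|a_n|\le\frac1{k+1}$ for all $k\in\mathbb N$ and all $n\ge\varphi(k)$. A sequence $(z_n)$ is asymptotically regular with rate $\varphi$ if $\varphi$ is a rate of convergence of $(d(z_n,z_{n+1}))$ towards $0$, and, for $S:C\to C$ and $(z_n)$ in $C$, $S$-asymptotically regular with rate $\varphi$ if $\varphi$ is a rate of convergence of $(d(z_n,Sz_n))$ towards $0$. *)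

(* Defs.v *)
From mathcomp Require Import all_boot all_order all_algebra.
From mathcomp Require Import all_classical all_reals all_analysis.

Set Implicit Arguments.
Unset Strict Implicit.
Unset Printing Implicit Defensive.

Import Order.TTheory GRing.Theory Num.Theory.
Import numFieldNormedType.Exports.

Local Open Scope classical_set_scope.
Local Open Scope ring_scope.

(* [W x y l] stands for (1 - l) x + l y.  The paper's W is only defined for
   l in [0, 1]; here W is a total function of l : R and nothing is assumed
   about it outside [0, 1]. *)
Record W_hyperbolic (R : realType) (X : metricType R) (W : X -> X -> R -> X)
  : Prop := {
  W1 : forall (x y z : X) (l : R), 0 <= l <= 1 ->
    mdist z (W x y l) <= (1 - l) * mdist z x + l * mdist z y ;
  W2 : forall (x y : X) (l l' : R), 0 <= l <= 1 -> 0 <= l' <= 1 ->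
    mdist (W x y l) (W x y l') = `|l - l'| * mdist x y ;
  W3 : forall (x y : X) (l : R), 0 <= l <= 1 -> W x y l = W y x (1 - l) ;
  W4 : forall (x y z w : X) (l : R), 0 <= l <= 1 ->
    mdist (W x z l) (W y w l) <= (1 - l) * mdist x y + l * mdist z w
}.

(* Likewise eta, a function from (0, oo) x (0, 2] to (0, 1], is total here and
   constrained only on that domain. *)
Record monotone_modulus_of_uniform_convexity (R : realType) (X : metricType R)
    (W : X -> X -> R -> X) (eta : R -> R -> R) : Prop := {
  modulus_range : forall r e : R, 0 < r -> 0 < e <= 2 -> 0 < eta r e <= 1 ;
  modulus_convexity : forall (r e : R) (x y a : X), 0 < r -> 0 < e <= 2 ->
    mdist x a <= r -> mdist y a <= r -> e * r <= mdist x y ->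
    mdist (W x y (1 / 2)) a <= (1 - eta r e) * r ;
  modulus_monotone : forall r s e : R, 0 < e <= 2 -> 0 < r -> r <= s ->
    eta s e <= eta r e
}.

Definition UCW_hyperbolic (R : realType) (X : metricType R)
    (W : X -> X -> R -> X) (eta : R -> R -> R) : Prop :=
  W_hyperbolic W /\ monotone_modulus_of_uniform_convexity W eta.

Definition W_convex (R : realType) (X : metricType R) (W : X -> X -> R -> X)
    (C : set X) : Prop :=
  forall (x y : X) (l : R), C x -> C y -> 0 <= l <= 1 -> C (W x y l).

(* A mapping C -> C is a total S : X -> X that maps C into itself
   ([set_fun C C S]); only its values on C are used. *)
Definition nonexpansive_on (R : realType) (X : metricType R) (C : set X)
    (S : X -> X) : Prop :=
  forall x y : X, C x -> C y -> mdist (S x) (S y) <= mdist x y.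

Definition Fix (X : Type) (C : set X) (S : X -> X) : set X :=
  [set x | C x /\ S x = x].

Definition rate_of_convergence0 (R : realType) (a : nat -> R)
    (phi : nat -> nat) : Prop :=
  forall k n : nat, (phi k <= n)%N -> `|a n| <= 1 / (k.+1)%:R.

Definition cvg0_with_rate (R : realType) (a : nat -> R) (phi : nat -> nat)
  : Prop :=
  a @ \oo --> (0 : R) /\ rate_of_convergence0 a phi.

Definition asymptotically_regular (R : realType) (X : metricType R)
    (z : nat -> X) (phi : nat -> nat) : Prop :=
  rate_of_convergence0 (fun n => mdist (z n) (z n.+1)) phi.

Definition map_asymptotically_regular (R : realType) (X : metricType R)
    (S : X -> X) (z : nat -> X) (phi : nat -> nat) : Prop :=
  rate_of_convergence0 (fun n => mdist (z n) (S (z n))) phi.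

Definition alternating_Halpern_Mann (R : realType) (X : metricType R)
    (W : X -> X -> R -> X) (T U : X -> X) (x0 u : X) (alpha beta : nat -> R)
    (x y : nat -> X) : Prop :=
  [/\ x 0%N = x0,
      forall n : nat, y n = W (T (x n)) u (alpha n) &
      forall n : nat, x n.+1 = W (U (y n)) (y n) (beta n)].

(* The ceiling is an int; the quotient is positive under the standing
   assumptions, so taking the absolute value only changes the type to nat. *)
Definition Pconst (R : realType) (eta : R -> R -> R) (K L : nat) (k : nat)
  : nat :=
  `|Num.ceil (L%:R ^+ 2 / eta K%:R (1 / (K%:R * (k.+1)%:R)))|%N.

(* The subtractions below are in nat, and never truncated when
   K >= 1 and Pconst eta K L k >= 1. *)
Definition Gamma3 (R : realType) (eta : R -> R -> R) (K L : nat)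
    (Delta sigma1 : nat -> nat) (k : nat) : nat :=
  maxn (Delta (2 * Pconst eta K L k * k.+1 - 1)%N)
       (sigma1 (2 * Pconst eta K L k * K * k.+1 - 1)%N).

Definition Omega (R : realType) (eta : R -> R -> R) (K L : nat)
    (Delta sigma1 : nat -> nat) (k : nat) : nat :=
  maxn (Delta (2 * k + 1)%N) (Gamma3 eta K L Delta sigma1 (2 * k + 1)%N).

Definition Gamma4 (R : realType) (eta : R -> R -> R) (K L : nat)
    (Delta sigma1 : nat -> nat) (k : nat) : nat :=
  maxn (Omega eta K L Delta sigma1 (2 * k + 1)%N)
       (sigma1 (4 * K * k.+1 - 1)%N).

Definition Gamma5 (R : realType) (eta : R -> R -> R) (K L : nat)
    (Delta sigma1 : nat -> nat) (k : nat) : nat :=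
  maxn (Omega eta K L Delta sigma1 (4 * k + 3)%N)
       (Gamma3 eta K L Delta sigma1 (2 * k + 1)%N).

Definition Gamma6 (R : realType) (eta : R -> R -> R) (K L : nat)
    (Delta sigma1 : nat -> nat) (k : nat) : nat :=
  maxn (Omega eta K L Delta sigma1 (4 * k + 3)%N)
       (Gamma4 eta K L Delta sigma1 (2 * k + 1)%N).

(* Main.v *)
(* Since p is a fixed point, all the orbits stay in the ball of radius K around
   p.  If d(y_n, U y_n) > 1 / (k + 1), uniform convexity applied to U y_n, y_n
   and the centre p forces d(x_(n+1), p) to drop below d(y_n, p) by more than
   1 / (P (k + 1)), whereas d(y_n, p) - d(x_(n+1), p) is at most
   d(x_n, x_(n+1)) + K alpha_n, which is smaller for n large: this is (i).  The
   other rates follow from (i) by the triangle inequality. *)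
Require Import Defs.
From mathcomp Require Import all_boot all_order all_algebra.
From mathcomp Require Import all_classical all_reals all_analysis.
From mathcomp Require Import ring lra zify.
Import Order.TTheory GRing.Theory Num.Theory.
Import numFieldNormedType.Exports.
Local Open Scope classical_set_scope.
Local Open Scope ring_scope.

Lemma rate_of_convergence0_cvg (R : realType) (a : nat -> R) (phi : nat -> nat) :
  rate_of_convergence0 a phi -> a @ \oo --> (0 : R).
Proof.
move=> ha; apply/cvgrPdist_le => e e0.
near \oo => k.
have ke : k.+1%:R^-1 < e.
  by near: k; exact: (near_infty_natSinv_lt (PosNum e0)).
near=> n; rewrite sub0r normrN.
have /ha : (phi k <= n)%N by near: n; exact: nbhs_infty_ge.
by rewrite div1r => /le_trans; apply; exact: ltW.
Unshelve. all: by end_near. Qed.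

Lemma W_dist_left {R : realType} {X : metricType R} {W : X -> X -> R -> X}
    (hW : W_hyperbolic W) (x y : X) (l : R) :
  0 <= l <= 1 -> mdist (W x y l) x <= l * mdist x y.
Proof.
by move=> hl; rewrite metric_sym; have := W1 hW x y x hl; rewrite mdistxx; lra.
Qed.

Lemma W_dist_right {R : realType} {X : metricType R} {W : X -> X -> R -> X}
    (hW : W_hyperbolic W) (x y : X) (l : R) :
  0 <= l <= 1 -> mdist (W x y l) y <= (1 - l) * mdist x y.
Proof.
move=> hl; have := W1 hW x y y hl.
by rewrite mdistxx (metric_sym y x) (metric_sym y) mulr0 addr0.
Qed.

(* Uniform convexity gives strict convexity: the midpoint of two distinct
   candidates would be strictly closer to x. *)
Lemma metric_segment_unique {R : realType} {X : metricType R}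
    {W : X -> X -> R -> X} {eta : R -> R -> R} (hX : UCW_hyperbolic W eta)
    (x y z z' : X) (s t : R) :
  mdist z x <= s -> mdist z' x <= s -> mdist z y <= t -> mdist z' y <= t ->
  s + t <= mdist x y -> z = z'.
Proof.
case: hX => hW heta zx z'x zy z'y st; apply/eqP/negP => /negP zz'.
have d0 : 0 < mdist z z' by rewrite mdist_gt0.
have d2 : mdist z z' <= 2 * s.
  by have := metric_triangle z x z'; rewrite (metric_sym x z'); lra.
have s0 : 0 < s by lra.
have he : 0 < mdist z z' / s <= 2.
  by rewrite divr_gt0 //= ler_pdivrMr.
have /andP[eta0 _] := modulus_range heta s0 he.
have half01 : 0 <= (1 / 2 : R) <= 1 by lra.
have mx := modulus_convexity heta s0 he zx z'x.
have {}mx : mdist (W z z' (1 / 2)) x <= (1 - eta s (mdist z z' / s)) * s.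
  by apply: mx; rewrite divfK // gt_eqF.
(* The midpoint also stays within [t] of [y], so going from [x] to [y] through it takes strictly
   less than [s + t], a contradiction. *)
have my := W1 hW z z' y half01.
rewrite (metric_sym y z) (metric_sym y z') in my.
have := metric_triangle x (W z z' (1 / 2)) y.
rewrite (metric_sym x (W _ _ _)) (metric_sym (W _ _ _) y) => tri.
have : 0 < eta s (mdist z z' / s) * s by rewrite mulr_gt0.
lra.
Qed.

(* Both points satisfy the distance bounds l d(x, y) and (1 - l) d(x, y) that
   characterize W x y l. *)
Lemma W_midpoint_left {R : realType} {X : metricType R}
    {W : X -> X -> R -> X} {eta : R -> R -> R} (hX : UCW_hyperbolic W eta)
    (x y : X) (l : R) :
  0 <= l <= 1 / 2 -> W x (W x y (1 / 2)) (2 * l) = W x y l.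
Proof.
move=> hl; have hW := hX.1.
have hl1 : 0 <= l <= 1 by lra.
have h2l : 0 <= 2 * l <= 1 by lra.
have half01 : 0 <= (1 / 2 : R) <= 1 by lra.
have mx := W_dist_left hW x y _ half01.
have my := W_dist_right hW x y _ half01.
apply: (metric_segment_unique hX x y _ _
  (l * mdist x y) ((1 - l) * mdist x y)).
- have := W_dist_left hW x (W x y (1 / 2)) _ h2l.
  by rewrite (metric_sym x (W x y (1/2))); nra.
- exact: W_dist_left.
(* Seen from [y], the endpoint [x] has weight [1 - 2 * l] and the midpoint, at half the distance,
   weight [2 * l]: in total [1 - l]. *)
- have := W1 hW x (W x y (1 / 2)) y h2l.
  rewrite (metric_sym y x) (metric_sym y (W x y (1/2))) (metric_sym y); nra.
- exact: W_dist_right.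
- by rewrite -mulrDl addrC subrK mul1r.
Qed.

(** By (W3) one may take [l <= 1 / 2]. The point then lies at parameter [2 * l] between [x] and the
    midpoint, and (W1) averages the bound [r] at [x] with the improved bound at the midpoint. This
    yields the factor [1 - 2 * l * eta r e]; weakening [l] to [l * (1 - l)] makes the bound
    symmetric. *)
Lemma modulus_convexity_weighted {R : realType} {X : metricType R}
    {W : X -> X -> R -> X} {eta : R -> R -> R} (hX : UCW_hyperbolic W eta)
    (r e : R) (x y a : X) (l : R) :
  0 <= l <= 1 -> 0 < r -> 0 < e <= 2 -> mdist x a <= r -> mdist y a <= r ->
  e * r <= mdist x y ->
  mdist (W x y l) a <= (1 - 2 * l * (1 - l) * eta r e) * r.
Proof.
move=> + r0 he; have [hW heta] := hX.
wlog hl : x y l / l <= 1 / 2 => [IH l01 xa ya xy|l01 xa ya xy].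
  have [/IH|l2] := leP l (1 / 2); first exact.
  have -> : 2 * l * (1 - l) = 2 * (1 - l) * (1 - (1 - l)) by ring.
  by rewrite (W3 hW _ _ l01); apply: IH; rewrite 1?(metric_sym y x) //; lra.
have h2l : 0 <= 2 * l <= 1 by lra.
have hl2 : 0 <= l <= 1 / 2 by lra.
rewrite -(W_midpoint_left hX x y _ hl2) metric_sym.
apply: le_trans (W1 hW _ _ a h2l) _.
have := modulus_convexity heta r0 he xa ya xy.
rewrite (metric_sym a x) (metric_sym a (W _ _ _)) => mid.
have /andP[eta0 _] := modulus_range heta r0 he.
have er : 0 < eta r e * r by rewrite mulr_gt0.
apply: (@le_trans _ _ ((1 - 2 * l) * r + 2 * l * ((1 - eta r e) * r))).
  by apply: lerD; apply: ler_wpM2l => //; lra.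
have : 0 <= 2 * l * l * (eta r e * r).
  by rewrite mulr_ge0 ?(ltW er) // mulr_ge0; lra.
lra.
Qed.

(** Convexity is applied at the actual radius [mdist y p], where the relative separation [d / B] is
    still valid since [mdist y p <= B]. The gain is proportional to [2 * mdist y p], which exceeds
    [d] because [z] is no farther from [p] than [y]. Monotonicity then replaces the unknown radius
    by [B] inside [eta]. *)
Lemma dist_decrease {R : realType} {X : metricType R}
    {W : X -> X -> R -> X} {eta : R -> R -> R} (hX : UCW_hyperbolic W eta)
    (y z p : X) (B c d l : R) :
  0 <= l <= 1 -> 0 < c -> c <= l * (1 - l) -> 0 < d -> d < mdist y z ->
  mdist z p <= mdist y p -> mdist y p <= B ->
  c * d * eta B (d / B) < mdist y p - mdist (W z y l) p.
Proof.
move=> l01 c0 cl d0 dyz zp yB; have [hW heta] := hX.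
have d2 : d < 2 * mdist y p.
  by have := metric_triangle y p z; rewrite (metric_sym p z); lra.
have r0 : 0 < mdist y p by lra.
have B0 : 0 < B by lra.
have he : 0 < d / B <= 2 by rewrite divr_gt0 //= ler_pdivrMr //; lra.
have dr : d / B * mdist y p <= mdist z y.
  rewrite (metric_sym z); apply: le_trans (ltW dyz).
  by rewrite mulrAC -mulrA ler_piMr ?(ltW d0) // ler_pdivrMr // mul1r.
have := modulus_convexity_weighted hX _ _ _ _ p _ l01 r0 he zp (lexx _) dr.
have mono := modulus_monotone heta he r0 yB.
have /andP[etaB0 _] := modulus_range heta B0 he.
set h := eta (mdist y p) _ in mono *; set g := eta B _ in mono etaB0 *.
set r := mdist y p in r0 d2 *.
move=> dec; apply: (@lt_le_trans _ _ (2 * (l * (1 - l)) * h * r)); last by lra.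
apply: (@lt_le_trans _ _ (c * (2 * r) * g)).
  by rewrite ltr_pM2r // ltr_pM2l.
have -> : c * (2 * r) * g = c * g * (2 * r) by ring.
have -> : 2 * (l * (1 - l)) * h * r = l * (1 - l) * h * (2 * r) by ring.
apply: ler_wpM2r; first by lra.
by apply: ler_pM => //; lra.
Qed.

(** Explains the indices of the form [m * k.+1 - 1]: a rate evaluated there guarantees the error
    [1 / (m * k.+1)]. Positivity of [m] keeps the subtraction from truncating. *)
Lemma natM_le_invn {R : realType} (a : R) (m k : nat) :
  (0 < m)%N -> a <= 1 / (m * k.+1 - 1).+1%:R -> m%:R * a <= 1 / k.+1%:R.
Proof.
move=> m0; rewrite subn1 prednK ?muln_gt0 ?m0 // natrM.
have mR : 0 < m%:R :> R by rewrite ltr0n.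
have kR : 0 < k.+1%:R :> R by rewrite ltr0n.
by rewrite !ler_pdivlMr ?mulr_gt0 // mulrA -[a * _ in X in X -> _]mulrC.
Qed.

Theorem proposition3p5 (R : realType) (X : metricType R)
    (W : X -> X -> R -> X) (eta : R -> R -> R)
    (hX : UCW_hyperbolic W eta)
    (C : set X) (hC0 : C !=set0) (hC : W_convex W C)
    (T U : X -> X) (hTC : set_fun C C T) (hUC : set_fun C C U)
    (hT : nonexpansive_on C T) (hU : nonexpansive_on C U)
    (hFix : (Fix C T `&` Fix C U) !=set0)
    (x0 u : X) (hx0 : C x0) (hu : C u)
    (alpha beta : nat -> R)
    (halpha : forall n : nat, 0 <= alpha n <= 1)
    (hbeta : forall n : nat, 0 <= beta n <= 1)
    (x y : nat -> X)
    (hxy : alternating_Halpern_Mann W T U x0 u alpha beta x y)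
    (p : X) (hp : (Fix C T `&` Fix C U) p)
    (K : nat) (hK1 : (1 <= K)%N)
    (hK : Num.max (mdist x0 p) (mdist u p) <= K%:R)
    (sigma1 : nat -> nat) (hsigma1 : cvg0_with_rate alpha sigma1)
    (L : nat) (hL2 : (2 <= L)%N)
    (hL : forall n : nat, 1 / L%:R <= beta n <= 1 - 1 / L%:R)
    (Delta : nat -> nat) (hDelta : asymptotically_regular x Delta) :
  [/\ map_asymptotically_regular U y (Gamma3 eta K L Delta sigma1),
      cvg0_with_rate (fun n => mdist (x n) (y n)) (Omega eta K L Delta sigma1),
      map_asymptotically_regular T y (Gamma4 eta K L Delta sigma1),
      map_asymptotically_regular U x (Gamma5 eta K L Delta sigma1) &
      map_asymptotically_regular T x (Gamma6 eta K L Delta sigma1)].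

Proof.
have [hW heta] := hX; have [hx0' hy hx] := hxy.
have [[Cp Tp] [_ Up]] := hp.
move: hK; rewrite ge_max => /andP[x0K uK].
have K0 : 0 < K%:R :> R by rewrite ltr0n.
have Cx n : C (x n).
  elim: n => [|n Cxn]; first by rewrite hx0'.
  have Cy : C (y n) by rewrite hy; apply: hC => //; exact: hTC.
  by rewrite hx; apply: hC => //; exact: hUC.
have Cy n : C (y n) by rewrite hy; apply: hC => //; exact: hTC.
have Txp n : mdist (T (x n)) p <= mdist (x n) p by rewrite -{1}Tp; exact: hT.
have Uyp n : mdist (U (y n)) p <= mdist (y n) p by rewrite -{1}Up; exact: hU.
have yp n : mdist (y n) p <= (1 - alpha n) * mdist (x n) p + alpha n * mdist u p.
  rewrite hy metric_sym; apply: le_trans (W1 hW _ _ p (halpha n)) _.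
  rewrite (metric_sym p u) (metric_sym p) lerD2r ler_wpM2l //.
  by have := halpha n; lra.
have xK n : mdist (x n) p <= K%:R.
  elim: n => [|n IH]; first by rewrite hx0'.
  have ypn : mdist (y n) p <= K%:R by have := yp n; have := halpha n; nra.
  rewrite hx metric_sym; apply: le_trans (W1 hW _ _ p (hbeta n)) _.
  rewrite !(metric_sym p); have := Uyp n; have := hbeta n; nra.
have yK n : mdist (y n) p <= K%:R.
  by have := yp n; have := xK n; have := halpha n; nra.
have ypx n : mdist (y n) p <= mdist (x n) p + alpha n * K%:R.
  by have := yp n; have := mdist_ge0 (x n) p; have := halpha n; nra.
have alphaK m k n : (0 < m)%N -> (sigma1 (m * K * k.+1 - 1) <= n)%N ->
    m%:R * (K%:R * alpha n) <= 1 / k.+1%:R.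
  move=> m0 /hsigma1.2 /(le_trans (ler_norm _)) /natM_le_invn.
  by rewrite natrM -mulrA; apply; rewrite muln_gt0 m0.
have reg m k n : (0 < m)%N -> (Delta (m * k.+1 - 1) <= n)%N ->
    m%:R * mdist (x n) (x n.+1) <= 1 / k.+1%:R.
  by move=> m0 /hDelta /(le_trans (ler_norm _)) /natM_le_invn; apply.
have G3 : map_asymptotically_regular U y (Gamma3 eta K L Delta sigma1).
  move=> k n; rewrite /Gamma3 geq_max => /andP[nDelta nsigma].
  rewrite ger0_norm ?mdist_ge0 // leNgt; apply/negP => dyU.
  have k0 : 0 < 1 / k.+1%:R :> R by rewrite divr_gt0.
  have L0 : 0 < L%:R :> R by rewrite ltr0n ltnW.
  have L20 : 0 < 1 / L%:R ^+ 2 :> R by rewrite divr_gt0 // exprn_gt0.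
  (* Both factors are at least [1 / L], whence the square in [Pconst]. *)
  have Lbeta : 1 / L%:R ^+ 2 <= beta n * (1 - beta n).
    have /andP[b1 b2] := hL n.
    have -> : 1 / L%:R ^+ 2 = (1 / L%:R) * (1 / L%:R) :> R.
      by rewrite !div1r expr2 invfM.
    by apply: ler_pM; rewrite ?divr_ge0 //; lra.
  have := dist_decrease hX _ _ _ _ _ _ _ (hbeta n) L20 Lbeta k0 dyU (Uyp n) (yK n).
  rewrite -hx.
  have -> : 1 / k.+1%:R / K%:R = 1 / (K%:R * k.+1%:R) :> R.
    by rewrite !div1r invfM mulrC.
  have he : 0 < (1 : R) / (K%:R * k.+1%:R) <= 2.
    rewrite divr_gt0 ?mulr_gt0 //= ler_pdivrMr ?mulr_gt0 //.
    by rewrite -!natrM ler1n; lia.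
  have := modulus_range heta K0 he.
  move: nDelta nsigma.
  rewrite /Pconst; set g := eta _ _; set P := `|_|%N => nDelta nsigma /andP[g0 _].
  have gP : L%:R ^+ 2 / g <= P%:R.
    have := Num.Theory.ceil_ge (L%:R ^+ 2 / g) => /le_trans; apply.
    by rewrite /P natr_absz ler_int ler_norm.
  (* Needed so that the subtractions in [Gamma3] do not truncate. *)
  have P0 : (0 < P)%N.
    by rewrite -(ltr0n R) (lt_le_trans _ gP) // divr_gt0 ?exprn_gt0.
  have PR : 0 < P%:R :> R by rewrite ltr0n.
  have gk : 1 / k.+1%:R <= P%:R * (1 / L%:R ^+ 2 * (1 / k.+1%:R) * g).
    have -> : P%:R * (1 / L%:R ^+ 2 * (1 / k.+1%:R) * g) =
      P%:R * g / L%:R ^+ 2 * (1 / k.+1%:R) by ring.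
    rewrite ler_peMl ?(ltW k0) // ler_pdivlMr ?exprn_gt0 // mul1r.
    by rewrite -ler_pdivrMr.
  move=> dec.
  have P2 : (0 < 2 * P)%N by rewrite muln_gt0.
  have := reg _ _ _ P2 nDelta; have := alphaK _ _ _ P2 nsigma.
  rewrite natrM => a1 d1.
  have tri := metric_triangle (x n) (x n.+1) p.
  (* By [gk] the left side is at least [1 / k.+1]. On the right, the factor 2 in the indices of
     [Gamma3] lets each summand contribute at most half of [1 / k.+1]. *)
  have : P%:R * (1 / L%:R ^+ 2 * (1 / k.+1%:R) * g) <
      P%:R * (mdist (x n) (x n.+1) + K%:R * alpha n).
    by rewrite ltr_pM2l //; apply: lt_le_trans dec _; have := ypx n; lra.
  by move/(le_lt_trans gk); rewrite mulrDr; move: a1 d1; move: (1 / _) => d; lra.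
have half k : 2 * (1 / (2 * k + 1).+1%:R) = 1 / k.+1%:R :> R.
  have -> : (2 * k + 1).+1 = (2 * k.+1)%N by lia.
  by rewrite natrM !div1r invfM mulrA divff // mul1r.
have quarter k : 4 * (1 / (4 * k + 3).+1%:R) = 1 / k.+1%:R :> R.
  have -> : (4 * k + 3).+1 = (4 * k.+1)%N by lia.
  by rewrite natrM !div1r invfM mulrA divff // mul1r.
have G2 : rate_of_convergence0 (fun n => mdist (x n) (y n))
    (Omega eta K L Delta sigma1).
  move=> k n; rewrite /Omega geq_max => /andP[/hDelta d1 /G3 d2].
  move: d1 d2; rewrite !ger0_norm ?mdist_ge0 // -(half k) => d1 d2.
  have := metric_triangle (x n) (x n.+1) (y n).
  have := W_dist_right hW (U (y n)) (y n) _ (hbeta n).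
  rewrite -hx (metric_sym (U _)) => xy'.
  have {}xy' : mdist (x n.+1) (y n) <= mdist (y n) (U (y n)).
    apply: le_trans xy' _; rewrite ler_piMl ?mdist_ge0 //.
    by have := hbeta n; lra.
  move: (1 / _) d1 d2 => d d1 d2; lra.
have G4 : map_asymptotically_regular T y (Gamma4 eta K L Delta sigma1).
  move=> k n; rewrite /Gamma4 geq_max => /andP[/G2 d1 /(alphaK 4) a1].
  have {}a1 := a1 isT.
  move: d1; rewrite !ger0_norm ?mdist_ge0 // => d1.
  rewrite -(half k) in a1 *; move: (1 / _) d1 a1 => d d1 a1.
  have yT := W_dist_left hW (T (x n)) u _ (halpha n).
  rewrite -hy in yT.
  have := metric_triangle (y n) (T (x n)) (T (y n)).
  have := hT _ _ (Cx n) (Cy n).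
  (* Since [y n] is within [alpha n * mdist (T (x n)) u] of [T (x n)], this gives an error
     [2 * K * alpha n]. Making it at most half of [1 / k.+1] requires the 4 in [Gamma4]. *)
  have : mdist (T (x n)) u <= 2 * K%:R.
    have := metric_triangle (T (x n)) p u; rewrite (metric_sym p u).
    by have := Txp n; have := xK n; lra.
  by have := halpha n; nra.
(* Passing through [y n] and [S (y n)] costs [mdist (x n) (y n)] twice and [mdist (y n) (S (y n))]
   once, hence a quarter of the tolerance for [Omega] and half for [phi]. Taking [U] with [Gamma3]
   and [T] with [Gamma4] gives (iv) and (v). *)
have from_y S phi : nonexpansive_on C S -> map_asymptotically_regular S y phi ->
    map_asymptotically_regular S x (fun k =>
      maxn (Omega eta K L Delta sigma1 (4 * k + 3)) (phi (2 * k + 1)%N)).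
  move=> hS hphi k n; rewrite geq_max => /andP[/G2 d1 /hphi d2].
  move: d1 d2; rewrite !ger0_norm ?mdist_ge0 // => d1 d2.
  move: (1 / _) (1 / _) (1 / _) (half k) (quarter k) d1 d2 => a b c h q d1 d2.
  have := hS _ _ (Cx n) (Cy n).
  have := metric_triangle (x n) (y n) (S (x n)).
  have := metric_triangle (y n) (S (y n)) (S (x n)).
  rewrite (metric_sym (S (y n))); lra.
split=> //; first by split=> //; exact: rate_of_convergence0_cvg G2.
- exact: from_y.
- exact: from_y.
Qed.
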